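(* Let $\mathcal X$ be a complex Banach space, $S$ a topological group, and $\alpha\colon S\to\mathcal B(\mathcal X)$, $s\mapsto\alpha_s$, a norm continuous representation of $S$ by bounded linear operators on $\mathcal X$ (so $\alpha_{st}=\alpha_s\alpha_t$ for all $s,t\in S$, and $s\mapsto\alpha_s$ is continuous for the operator norm) such that $\alpha_{\mathbf 1}=\mathrm{id}_{\mathcal X}$ and $\sup_{s\in S}\|\alpha_s\|<\infty$. Assume that one of the following hypotheses holds: (a) $S$ is an amenable topological group and $\mathcal X$ is a dual Banach space such that $\alpha_s\colon\mathcal X\to\mathcal X$ is weak$^*$-continuous for all $s\in S$; or (b) $S$ is a compact topological group. Denote $\mathcal X^S=\{x\in\mathcal X\mid\alpha_s(x)=x\text{ for all }s\in S\}$. Then there exists a bounded linear operator $P\in\mathcal B(\mathcal X)$ such that $\|P\|\le\sup_{s\in S}\|\alpha_s\|$, $\operatorname{Ran}P=\mathcal X^S$ and $P^2=P$.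
   Context: Amenable topological group: for a topological group $S$ and $f\colon S\to\mathbb C$ bounded, put $(L_tf)(s)=f(ts)$. Let $\mathcal{RUC}_b(S)$ be the space of all bounded continuous $f\colon S\to\mathbb C$ such that $s\mapsto L_sf$ is continuous in the sup norm. $S$ is amenable if there is a linear functional $\mu$ on $\mathcal{RUC}_b(S)$ with $\|\mu\|=\mu(\mathbf 1)=1$ and $\mu\circ L_t=\mu$ for all $t\in S$. *)

(* Defs.v *)
From HB Require Import structures.
From mathcomp Require Import all_boot all_order all_algebra.
From mathcomp Require Import all_classical all_reals all_analysis.
From mathcomp.real_closed Require Import complex.

Set Implicit Arguments.
Unset Strict Implicit.
Unset Printing Implicit Defensive.

Import Order.TTheory GRing.Theory Num.Theory.
Import numFieldNormedType.Exports.

Local Open Scope classical_set_scope.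
Local Open Scope ring_scope.

HB.mixin Record PreTopologicalGroup_isTopologicalGroup S
    & Topological S & Group S := {
  mulg_continuous : continuous (fun p : S * S => (p.1 * p.2)%g) ;
  invg_continuous : continuous (fun s : S => (s^-1)%g) ;
}.

(* No separation axiom is imposed. *)
#[short(type="topologicalGroupType")]
HB.structure Definition TopologicalGroup :=
  {S of Topological S & Group S & PreTopologicalGroup_isTopologicalGroup S}.

Section Norms.
Context {R : realType}.

(* A norm over R[i] takes its values in R[i], on the real axis. *)
Definition rnorm {V : normedZmodType R[i]} (x : V) : R := complex.Re `|x|.

Definition opnorm {V W : normedZmodType R[i]} (f : V -> W) : \bar R :=
  ereal_sup [set (rnorm (f x))%:E | x in [set x : V | rnorm x <= 1]].

Definition bounded_op {V W : normedZmodType R[i]} (f : V -> W) : Prop :=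
  (opnorm f < +oo)%E.

Definition supnorm {T : Type} (f : T -> R[i]) : \bar R :=
  ereal_sup (range (fun t => (rnorm (f t))%:E)).

End Norms.

Section Amenability.
Context (R : realType) (S : topologicalGroupType).

Definition ltranslate (t : S) (f : S -> R[i]) : S -> R[i] :=
  fun s => f (t * s)%g.

Definition RUCb : set (S -> R[i]) :=
  [set f | [/\ (supnorm f < +oo)%E,
               continuous (f : S -> R[i]^o) &
               forall s : S,
                 supnorm (fun u => ltranslate t f u - ltranslate s f u)
                   @[t --> s] --> 0%E]].

(* Functionals on the subspace RUCb are represented by functions on all of
   S -> R[i], of which only the values on RUCb matter. *)
Definition RUCb_linear (mu : (S -> R[i]) -> R[i]) : Prop :=
  forall (a : R[i]) (f g : S -> R[i]), RUCb f -> RUCb g ->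
    mu (fun s => a * f s + g s) = a * mu f + mu g.

Definition RUCb_dual_norm (mu : (S -> R[i]) -> R[i]) : \bar R :=
  ereal_sup [set (rnorm (mu f))%:E
            | f in [set f | RUCb f /\ (supnorm f <= 1)%E]].

Definition amenable : Prop :=
  exists mu : (S -> R[i]) -> R[i],
    [/\ RUCb_linear mu,
        RUCb_dual_norm mu = 1%E,
        mu (fun _ => 1) = 1 &
        forall (t : S) (f : S -> R[i]), RUCb f -> mu (ltranslate t f) = mu f].

End Amenability.

Section DualBanach.
Context {R : realType} {X Y : completeNormedModType R[i]}.

(* J is an isometric isomorphism from X onto the dual Banach space of Y *)
Definition dual_iso (J : X -> {linear Y -> R[i]^o}) : Prop :=
  [/\ forall (a : R[i]) (x x' : X) (y : Y),
        J (a *: x + x') y = a * J x y + J x' y,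
      forall x : X, opnorm (J x) = (rnorm x)%:E &
      forall phi : {linear Y -> R[i]^o}, bounded_op phi ->
        exists x : X, forall y : Y, J x y = phi y].

(* X with the topology of pointwise convergence on the predual Y *)
Definition weak_star (J : X -> {linear Y -> R[i]^o}) :=
  initial_topology (fun x : X => (J x : {ptws Y -> R[i]^o})).

HB.instance Definition _ J := Topological.on (weak_star J).

Definition weak_star_continuous (J : X -> {linear Y -> R[i]^o})
    (f : X -> X) : Prop :=
  continuous (f : weak_star J -> weak_star J).

End DualBanach.

(* Main.v *)
(* Amenable case: if mu is an invariant mean, then
   J (P x) y := mu (s |-> J (alpha_s x) y) defines P x in the dual space, and
   alpha_t P = P because the weak-star continuous alpha_t has a preadjoint on
   the predual, which turns alpha_t into a left translation under mu.

   Compact case: no Haar measure is needed. Let M be the average of alpha_s over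
   the points of a sufficiently fine finite net of S for the pseudometric
   |alpha_s - alpha_t|. One application of M shrinks the diameter of every orbit
   by a factor q < 1 that does not depend on the orbit, because each alpha_v x
   lies within half that diameter of one of the averaged vectors. Hence
   P x := lim M^n x exists, and its orbit has diameter 0. *)

Require Import Defs.
From HB Require Import structures.
From mathcomp Require Import all_boot all_order all_algebra.
From mathcomp Require Import all_classical all_reals all_analysis.
From mathcomp.real_closed Require Import complex.
From mathcomp Require Import ring lra.

Set Implicit Arguments.
Unset Strict Implicit.
Unset Printing Implicit Defensive.

Import Order.TTheory GRing.Theory Num.Theory.
Import numFieldNormedType.Exports.

Local Open Scope classical_set_scope.
Local Open Scope ring_scope.

(** * Real-valued norms, operator bounds and geometric convergence *)

Section RealNorm.
Context {R : realType}.

Section NormedZmod.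
Context {V : normedZmodType R[i]}.
Implicit Types x y : V.

Lemma rnormE x : `|x| = (rnorm x)%:C%C.
Proof. by rewrite /rnorm RRe_real // normr_real. Qed.

Lemma rnorm_ge0 x : 0 <= rnorm x.
Proof. by rewrite -ler0c -rnormE. Qed.

Lemma rnorm0 : rnorm (0 : V) = 0.
Proof. by rewrite /rnorm normr0. Qed.

Lemma rnorm_eq0 x : rnorm x = 0 -> x = 0.
Proof. by move=> x0; apply/normr0_eq0; rewrite rnormE x0. Qed.

Lemma rnormN x : rnorm (- x) = rnorm x.
Proof. by rewrite /rnorm normrN. Qed.

Lemma rdistC x y : rnorm (x - y) = rnorm (y - x).
Proof. by rewrite -rnormN opprB. Qed.

Lemma ler_rnormD x y : rnorm (x + y) <= rnorm x + rnorm y.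
Proof. by rewrite -lecR rmorphD /= -!rnormE ler_normD. Qed.

Lemma ler_rnormB x y : rnorm (x - y) <= rnorm x + rnorm y.
Proof. by rewrite -(rnormN y) ler_rnormD. Qed.

Lemma ler_rdistD z x y : rnorm (x - y) <= rnorm (x - z) + rnorm (z - y).
Proof. by rewrite (le_trans _ (ler_rnormD _ _))// addrA subrK. Qed.

Lemma ler_rnorm_sum (I : Type) (r : seq I) (F : I -> V) :
  rnorm (\sum_(i <- r) F i) <= \sum_(i <- r) rnorm (F i).
Proof.
elim/big_ind2: _ => // [|x a y b xa yb]; first by rewrite rnorm0.
exact: le_trans (ler_rnormD _ _) (lerD xa yb).
Qed.

End NormedZmod.

Lemma rnorm_complex (a : R) : 0 <= a -> rnorm (a%:C%C : R[i]) = a.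
Proof. by move=> a0; rewrite /rnorm ger0_norm// ler0c. Qed.

Lemma rnormM (a b : R[i]) : rnorm (a * b) = rnorm a * rnorm b.
Proof. by apply: complexI; rewrite rmorphM /= -!rnormE normrM. Qed.

Lemma rnormZ (V : normedModType R[i]) (a : R[i]) (x : V) :
  rnorm (a *: x) = rnorm a * rnorm x.
Proof. by apply: complexI; rewrite rmorphM /= -!rnormE normrZ. Qed.

Section OperatorNorm.
Context {V W : normedModType R[i]}.
Implicit Types f : V -> W.

Lemma opnorm_ge0 f : f 0 = 0 -> (0 <= opnorm f)%E.
Proof.
move=> f0; apply: ereal_sup_ubound; exists 0; first by rewrite /= rnorm0.
by rewrite f0 rnorm0.
Qed.

Lemma opnorm_le f (M : R) : 0 <= M ->
  (forall x, rnorm (f x) <= M * rnorm x) -> (opnorm f <= M%:E)%E.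
Proof.
move=> M0 fM; apply: ge_ereal_sup => _ [x /= x1 <-]; rewrite lee_fin.
by rewrite (le_trans (fM x))// ler_piMr.
Qed.

(** Stated for bare scalable functions so that it also covers the difference
    [alpha t x - alpha s x], which is not bundled as a linear map. *)
Lemma le_opnorm f (M : R) : scalable f -> (opnorm f <= M%:E)%E ->
  forall x, rnorm (f x) <= M * rnorm x.
Proof.
move=> fZ fM x; have [x0|x0] := eqVneq (rnorm x) 0.
  rewrite (rnorm_eq0 x0) -(scale0r (0 : V)) fZ scale0r rnorm0.
  by rewrite scale0r rnorm0 mulr0.
have xp : 0 < rnorm x by rewrite lt_neqAle eq_sym x0 rnorm_ge0.
pose a := ((rnorm x)^-1)%:C%C : R[i].
have an : rnorm a = (rnorm x)^-1 by rewrite rnorm_complex// invr_ge0 ltW.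
have : ((rnorm (f (a *: x)))%:E <= M%:E)%E.
  apply: le_trans fM; apply: ereal_sup_ubound; exists (a *: x) => //=.
  by rewrite rnormZ an mulVf.
by rewrite lee_fin fZ rnormZ an mulrC ler_pdivrMr.
Qed.

End OperatorNorm.

(** Passage to the limit, used to discard the error made when a limit is replaced by an iterate. *)
Lemma ler_addgeo (a b K q : R) : 0 <= q < 1 ->
  (forall n, a <= b + K * q ^+ n) -> a <= b.
Proof.
move=> /andP[q0 q1] aK.
have : (b + K * q ^+ n) @[n --> \oo] --> b + 0.
  apply: cvgD; first exact: cvg_cst.
  by apply: cvg_geometric; rewrite ger0_norm.
rewrite addr0 => bK; rewrite -(cvg_lim _ bK)//.
by apply: limr_ge; [exact: cvgP bK|exact: nearW].
Qed.

(** The rate is kept because linearity, invariance and the norm bound of the limit operator are all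
    read off from it. *)
Lemma geometric_cvg (X : completeNormedModType R[i]) (u : nat -> X) (K q : R) :
  0 <= q < 1 ->
  (forall m n, rnorm (u (m + n)%N - u n) <= K * q ^+ n) ->
  exists l : X, forall n, rnorm (u n - l) <= K * q ^+ n.
Proof.
move=> /andP[q0 q1] uK.
have K0 : 0 <= K.
  by have := uK 0%N 0%N; rewrite subrr rnorm0 expr0 mulr1.
have geo : K * q ^+ n @[n --> \oo] --> 0.
  by apply: cvg_geometric; rewrite ger0_norm.
(* Radii of balls in [X] lie in [R[i]]; a positive one is real, so it is compared through its real
   part. *)
have small (e : R[i]) : 0 < e ->
    exists N, forall n, (N <= n)%N -> ((K * q ^+ n)%:C%C : R[i]) < e.
  move=> e0; have eR : e = (complex.Re e)%:C%C by rewrite RRe_real// gtr0_real.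
  have e1 : 0 < complex.Re e by rewrite -ltcR -eR.
  have /cvgrPdist_lt/(_ _ e1)[N _ HN] := geo.
  exists N => n Nn; rewrite eR ltcR; have := HN n Nn.
  by rewrite /= sub0r normrN ger0_norm// mulr_ge0// exprn_ge0.
have cu : cauchy (u @ \oo).
  apply: cauchy_exP => e e0; have [N HN] := small e e0.
  exists (u N); exists N => // n /= Nn; rewrite -ball_normE /=.
  rewrite distrC rnormE (le_lt_trans _ (HN N (leqnn N)))// lecR.
  by rewrite -{1}(subnK Nn).
have /cauchy_cvg/cvg_ex[l /cvgrPdist_lt ul] := cu; exists l => n.
apply/ler_addgt0Pr => e e0; have e0' : 0 < (e%:C%C : R[i]) by rewrite ltcR.
have [N _ HN] := ul _ e0'; have {HN} := HN (N + n)%N (leq_addr _ _).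
rewrite /= rnormE ltcR rdistC => /ltW uNl.
by apply: le_trans (ler_rdistD (u (N + n)%N) _ _) _; rewrite lerD// rdistC.
Qed.

End RealNorm.

Lemma linear_exists (K : pzRingType) (U V : lmodType K) (f : U -> V) :
  linear f -> exists g : {linear U -> V}, g =1 f.
Proof.
move=> lf; pose m := GRing.isLinear.Build K U V *:%R f lf.
pose g : {linear U -> V} := HB.pack f m.
by exists g.
Qed.

(** Convexity of the norm: [z] is the mean of [size t] copies of itself. *)
Lemma rnorm_mean (R : realType) (X : normedModType R[i]) (T : Type)
    (t : seq T) (F : T -> X) (z : X) : (0 < size t)%N ->
  rnorm (((size t)%:R^-1)%:C%C *: (\sum_(i <- t) F i) - z) <=
  (size t)%:R^-1 * \sum_(i <- t) rnorm (F i - z).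
Proof.
move=> t0; have n0 : (size t)%:R != 0 :> R by rewrite pnatr_eq0 -lt0n.
have zE : z = ((size t)%:R^-1)%:C%C *: \sum_(i <- t) z.
  rewrite big_const_seq count_predT iter_addr_0 -[z *+ _]scaler_nat scalerA.
  rewrite -[X in _ * X](rmorph_nat (real_complex R)) -rmorphM /= mulVf//.
  by rewrite scale1r.
rewrite {1}zE -scalerBr rnormZ rnorm_complex ?invr_ge0//.
rewrite -sumrB ler_wpM2l ?invr_ge0//.
by rewrite (le_trans (ler_rnorm_sum _ _)).
Qed.

(** * Averages over finite lists and the compact case *)

Section Representation.
Context {R : realType} {X : completeNormedModType R[i]}.
Context {S : topologicalGroupType} (alpha : S -> {linear X -> X}) (C : R).
Hypothesis alpha_mul : forall (s t : S) (x : X),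
  alpha (s * t)%g x = alpha s (alpha t x).
Hypothesis alpha_one : forall x : X, alpha 1%g x = x.
Hypothesis alphaC : forall s x, rnorm (alpha s x) <= C * rnorm x.
Hypothesis C0 : 0 < C.

Lemma near_rnorm_le s (e : R) :
  opnorm (fun x : X => alpha t x - alpha s x) @[t --> s] --> 0%E -> 0 < e ->
  \forall t \near s, forall x, rnorm (alpha t x - alpha s x) <= e * rnorm x.
Proof.
move=> + e0 => /(_ [set d | (d < e%:E)%E]) H.
have /H : nbhs (0%E : \bar R) [set d | (d < e%:E)%E].
  have : \forall r \near (0 : R), r < e.
    by apply: open_nbhs_nbhs; split => //; exact: open_lt.
  by apply: filterS => r /= re; rewrite lte_fin.
rewrite /nbhs /=; apply: filterS => t /= /ltW te x.
apply: (@le_opnorm _ _ _ (fun x => alpha t x - alpha s x)) => // a y.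
by rewrite scalerBr !linearZ.
Qed.

Definition average (t : seq S) (x : X) : X :=
  ((size t)%:R^-1)%:C%C *: \sum_(s <- t) alpha s x.

Lemma average_linear t : linear (average t).
Proof.
move=> a x y; rewrite /average scalerA mulrC -scalerA -scalerDr.
congr (_ *: _).
by rewrite scaler_sumr -big_split; apply: eq_bigr => s _; rewrite linearP.
Qed.

Lemma iter_average_linear t k : linear (iter k (average t)).
Proof. by elim: k => // k IH a x y; rewrite !iterS IH average_linear. Qed.

Lemma average_fixed t x : (0 < size t)%N ->
  (forall s, alpha s x = x) -> average t x = x.
Proof.
move=> t0 xfix; apply/subr0_eq/rnorm_eq0/le_anti; rewrite rnorm_ge0 andbT.
apply: le_trans (rnorm_mean _ _ t0) _; rewrite big1 ?mulr0// => s _.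
by rewrite xfix subrr rnorm0.
Qed.

Lemma alpha_average s t x : alpha s (average t x) =
  ((size t)%:R^-1)%:C%C *: \sum_(u <- t) alpha (s * u)%g x.
Proof.
rewrite /average linearZ linear_sum; congr (_ *: _).
by apply: eq_bigr => u _; rewrite alpha_mul.
Qed.

(** By [alpha_average], the orbit of an average consists of averages of orbit points, and closed
    balls are convex. The centre [0] yields norm bounds, other centres yield distances. *)
Lemma iter_average_ball t x z r k : (0 < size t)%N ->
  (forall s, rnorm (alpha s x - z) <= r) ->
  forall s, rnorm (alpha s (iter k (average t) x) - z) <= r.
Proof.
move=> t0 xz; elim: k => // k IH s; rewrite iterS alpha_average.
apply: le_trans (rnorm_mean _ _ t0) _.
rewrite ler_pdivrMl ?ltr0n// mulr_natl -iter_addr_0 -count_predT -big_const_seq.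
by apply: ler_sum => u _; exact: IH.
Qed.

Lemma rnorm_iter_average t x r k : (0 < size t)%N ->
  (forall s, rnorm (alpha s x) <= r) -> rnorm (iter k (average t) x) <= r.
Proof.
move=> t0 xr; rewrite -(alpha_one (iter _ _ _)) -[alpha _ _]subr0.
by apply: iter_average_ball => // s; rewrite subr0.
Qed.

(** A bound on the diameter of the orbit of [x]; diameter [0] means that [x] is fixed. *)
Definition osc_le (x : X) (d : R) : Prop :=
  forall s t, rnorm (alpha s x - alpha t x) <= d.

Lemma osc_le_rnorm x : osc_le x (2 * C * rnorm x).
Proof.
move=> s t; rewrite -mulrA mulr_natl mulr2n.
by rewrite (le_trans (ler_rnormB _ _))// lerD.
Qed.

(** Since [x] lies on its own orbit, the ball of radius [d] around [x] contains that orbit. *)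
Lemma osc_le_dist t x d k : (0 < size t)%N -> osc_le x d ->
  rnorm (iter k (average t) x - x) <= d.
Proof.
move=> t0 xd; rewrite -[iter _ _ _]alpha_one.
by apply: iter_average_ball => // s; rewrite -[X in _ - X]alpha_one.
Qed.

(** The mean of one distance [d / 2] and [size t - 1] distances [d] is [shrink t * d]. *)
Definition shrink (t : seq S) : R := 1 - (2 * (size t)%:R)^-1.

Lemma shrink_itv t : (0 < size t)%N -> 0 <= shrink t < 1.
Proof.
move=> t0; have n1 : 1 <= (size t)%:R :> R by rewrite ler1n.
rewrite /shrink subr_ge0 gtrBl invr_gt0 invf_le1; last by lra.
by apply/andP; split; lra.
Qed.

Lemma osc_le_average t x d : (0 < size t)%N -> osc_le x d ->
  (forall s, exists2 u, u \in t &
    rnorm (alpha u x - alpha s x) <= d / (2 * C)) ->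
  osc_le (average t x) (shrink t * d).
Proof.
move=> t0 xd net.
have n0 : (size t)%:R != 0 :> R by rewrite pnatr_eq0 -lt0n.
have dist s v : rnorm (alpha s (average t x) - alpha v x) <= shrink t * d.
  (* Applying [alpha s] to a net point near [s^-1 * v] lands near [alpha v x]; the factor [C] this
     costs turns [d / (2 * C)] into [d / 2]. *)
  have [u ut uv] := net (s^-1 * v)%g.
  have {}uv : rnorm (alpha (s * u)%g x - alpha v x) <= d / 2.
    have {1}-> : v = (s * (s^-1 * v))%g by rewrite mulgA mulgV mul1g.
    rewrite (alpha_mul s u) (alpha_mul s (_ * _)%g) -linearB.
    rewrite (le_trans (alphaC _ _))// -ler_pdivlMl//.
    by rewrite (le_trans uv)// invfM mulrA mulrC.
  rewrite alpha_average; apply: le_trans (rnorm_mean _ _ t0) _.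
  rewrite (big_rem u)//=.
  have : \sum_(w <- rem u t) rnorm (alpha (s * w)%g x - alpha v x) <=
      (size t).-1%:R * d.
    rewrite -(size_rem ut) mulr_natl -iter_addr_0 -count_predT -big_const_seq.
    by apply: ler_sum => w _; exact: xd.
  move=> rest; apply: (@le_trans _ _ ((size t)%:R^-1 *
      (d / 2 + (size t).-1%:R * d))).
    by rewrite ler_wpM2l ?invr_ge0// lerD.
  rewrite -[in (size t).-1](prednK t0) /= /shrink -subn1 natrB//.
  by rewrite le_eqVlt; apply/orP; left; apply/eqP; field.
(* So far [dist] compares the new orbit with the old one. The ball around a point of the new orbit
   contains the old orbit, hence by convexity the new orbit too. *)
move=> s v.
rewrite rdistC; apply: (@iter_average_ball t x _ _ 1%N) => // w.
by rewrite rdistC.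
Qed.

Hypothesis alpha_cont : forall s : S,
  opnorm (fun x : X => alpha t x - alpha s x) @[t --> s] --> 0%E.
Hypothesis S_compact : compact [set: S].

Lemma finite_net (e : R) : 0 < e -> exists2 t : seq S, (0 < size t)%N &
  forall s, exists2 u, u \in t &
    forall x, rnorm (alpha u x - alpha s x) <= e * rnorm x.
Proof.
move=> e0.
pose P (l : seq S) s := exists2 u, u \in l &
  forall x, rnorm (alpha u x - alpha s x) <= e * rnorm x.
(* Lists are filtered by inclusion, so that the near-covering form of compactness produces a single
   list that works for every [s]. *)
pose F := filter_from [set: seq S] (fun l => [set l' : seq S | {subset l <= l'}]).
have FF : Filter F.
  apply: filter_from_filter; first by exists [::].
  move=> l l' _ _; exists (l ++ l') => // m lm; split => u ul; apply: lm.
    by rewrite mem_cat ul.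
  by rewrite mem_cat ul orbT.
have /compact_near_coveringP/(_ _ F P FF) := S_compact.
case=> [s _|l _ lP].
  exists ([set s' | forall x, rnorm (alpha s' x - alpha s x) <= e * rnorm x],
          [set l : seq S | s \in l]) => /=.
    split; first exact: near_rnorm_le.
    by exists [:: s] => // l; apply; rewrite mem_head.
  by move=> [s' l] /= [ss' sl]; exists s => // x; rewrite rdistC.
have lP' := lP l (fun _ => id).
(* A net point for [1] shows that [l] is nonempty. *)
by exists l => [|s]; [case: (lP' 1%g I) => u; case: (l)|exact: lP'].
Qed.

(** The list may depend on [x] and [e]: all iterates have norm at most [C * rnorm x], so one net,
    fine enough for this bound, contracts at every step until the oscillation reaches [e]. *)
Lemma osc_le_small x (e : R) : 0 < e ->
  exists2 t : seq S, (0 < size t)%N & exists k, osc_le (iter k (average t) x) e.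
Proof.
move=> e0; have x0 : 0 <= rnorm x := rnorm_ge0 x.
(* On vectors of norm at most [C * rnorm x] this fineness gives the error [e / (2 * C)] that
   [osc_le_average] accepts; the [+ 1] keeps the divisor positive. *)
pose d := e / (2 * C) / (C * (rnorm x + 1)).
have d0 : 0 < d by rewrite /d !divr_gt0 ?mulr_gt0//; lra.
have [t t0 net] := finite_net d0; exists t => //.
have /andP[q0 q1] := shrink_itv t0.
(* The maximum keeps the bound from falling below [e], where the fixed net would be too coarse. *)
pose D := 2 * C * rnorm x; pose b k := Num.max e (D * shrink t ^+ k).
have oscb k : osc_le (iter k (average t) x) (b k).
  elim: k => [|k IH].
    by move=> s u; rewrite le_max expr0 mulr1 osc_le_rnorm orbT.
  have xk : rnorm (iter k (average t) x) <= C * rnorm x.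
    exact: rnorm_iter_average.
  have /(osc_le_average t0 IH) step : forall s, exists2 u, u \in t &
      rnorm (alpha u (iter k (average t) x) - alpha s (iter k (average t) x))
        <= b k / (2 * C).
    move=> s; have [u ut us] := net s; exists u => //.
    rewrite (le_trans (us _))//.
    have -> : b k / (2 * C) = b k / (2 * C) / (C * (rnorm x + 1)) *
        (C * (rnorm x + 1)) by field; rewrite !gt_eqF//; lra.
    apply: ler_pM; rewrite ?rnorm_ge0 ?(ltW d0)//.
      by rewrite !ler_pM2r ?invr_gt0 ?mulr_gt0 ?le_max ?lexx//; lra.
    by rewrite (le_trans xk)// ler_pM2l//; lra.
  move=> s u; rewrite iterS (le_trans (step s u))// /b maxr_pMr//.
  rewrite exprS mulrCA ge_max !le_max lexx orbT andbT.
  by rewrite ler_piMl// ?ltW.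
have [N _ DN] : \forall k \near \oo, D * shrink t ^+ k < e.
  have : D * shrink t ^+ k @[k --> \oo] --> 0.
    by apply: cvg_geometric; rewrite ger0_norm.
  by move/cvgrPdist_lt/(_ _ e0); apply: filterS => k; rewrite sub0r normrN;
    apply: le_lt_trans; exact: ler_norm.
exists N => s u; rewrite (le_trans (oscb N s u))// ge_max lexx /=.
exact/ltW/DN/leqnn.
Qed.

(* [d] may be much smaller than [rnorm x], so the net is applied to [x - x'],
   where [x'] is an iterated average of [x] with small oscillation: then
   [rnorm (x - x') <= d]. *)
Lemma osc_le_contract t x d : (0 < size t)%N ->
  (forall s, exists2 u, u \in t &
    forall y, rnorm (alpha u y - alpha s y) <= (4 * C)^-1 * rnorm y) ->
  osc_le x d -> osc_le (average t x) (shrink t * d).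
Proof.
move=> t0 net xd; apply: osc_le_average => // s; have [u ut us] := net s.
exists u => //.
have : 0 <= d := le_trans (rnorm_ge0 _) (xd 1%g 1%g).
(* A positive target is required by [osc_le_small]; for [d = 0] the orbit is a single point. *)
rewrite le_eqVlt => /predU1P[d0|d0].
  by rewrite -d0 mul0r (le_trans (xd u s))// -d0.
have e0 : 0 < 1 / (4 * C) * d by rewrite mulr_gt0 ?divr_gt0 ?mulr_gt0.
have [t' t'0 [k]] := osc_le_small x e0.
set x' := iter k _ x => x'd.
have xx' : rnorm (x - x') <= d by rewrite rdistC osc_le_dist.
rewrite -(subrK x' x) (linearD (alpha u)) (linearD (alpha s)) opprD addrACA.
rewrite (le_trans (ler_rnormD _ _))//.
(* Half of the allowance goes to [x - x'] through the net, half to the oscillation of [x']. *)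
have -> : d / (2 * C) = (4 * C)^-1 * d + 1 / (4 * C) * d.
  by field; rewrite gt_eqF.
by rewrite lerD// (le_trans (us _))// ler_wpM2l// invr_ge0 mulr_ge0// ltW.
Qed.

(** The last clause takes an arbitrary orbit bound [r] in place of [C], so that the exact supremum
    can be inserted later. *)
Lemma compact_projection : exists P : {linear X -> X},
  [/\ forall s x, alpha s (P x) = P x,
      forall x, (forall s, alpha s x = x) -> P x = x &
      forall x r, (forall s, rnorm (alpha s x) <= r) -> rnorm (P x) <= r].
Proof.
(* The fineness asked by [osc_le_contract] is independent of the vector, so one list serves every
   [x] and the iterates are linear. *)
have [|t t0 net] := @finite_net (4 * C)^-1; first by rewrite invr_gt0 mulr_gt0.
have q01 := shrink_itv t0.
pose K (x : X) := 2 * C * rnorm x; pose q := shrink t.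
have osc x n : osc_le (iter n (average t) x) (K x * q ^+ n).
  elim: n => [|n IH]; first by rewrite expr0 mulr1; exact: osc_le_rnorm.
  by rewrite iterS exprS mulrCA; exact: osc_le_contract.
have /choice[P PK] x : exists l, forall n,
    rnorm (iter n (average t) x - l) <= K x * q ^+ n.
  (* Later iterates differ from the [n]-th by at most its oscillation. *)
  apply: geometric_cvg => // m n; rewrite iterD.
  exact: osc_le_dist.
have unique (x y : X) D : (forall n, rnorm (x - y) <= D * q ^+ n) -> x = y.
  move=> xy; apply/subr0_eq/rnorm_eq0/le_anti; rewrite rnorm_ge0 andbT.
  by apply: (ler_addgeo q01) => n; rewrite add0r; exact: xy.
have linP : linear P.
  (* One error term for the limit at [a *: x + y], the others for the limits at [x] and [y]. *)
  move=> a x y; apply: (unique _ _ (K (a *: x + y) + (rnorm a * K x + K y))) => n.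
  rewrite (le_trans (ler_rdistD (iter n (average t) (a *: x + y)) _ _))//.
  rewrite mulrDl lerD//; first by rewrite rdistC.
  rewrite iter_average_linear opprD addrACA -scalerBr.
  rewrite (le_trans (ler_rnormD _ _))// rnormZ mulrDl lerD// -mulrA.
  by rewrite ler_wpM2l// rnorm_ge0.
have [P' P'E] := linear_exists linP.
exists P'; split => [s x|x xfix|x r xr].
(* The three errors: replacing [P x] by an iterate under [alpha s], moving along the orbit of that
   iterate, and returning to [P x]. *)
- rewrite !P'E; apply: (unique _ _ (C * K x + (K x + K x))) => n.
  rewrite (le_trans (ler_rdistD (alpha s (iter n (average t) x)) _ _))//.
  rewrite mulrDl lerD//.
    by rewrite -linearB (le_trans (alphaC _ _))// -mulrA ler_pM2l// rdistC.
  rewrite (le_trans (ler_rdistD (iter n (average t) x) _ _))// mulrDl lerD//.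
  by rewrite -[X in _ - X]alpha_one; exact: osc.
- rewrite P'E; apply: (unique _ _ (K x)) => n; rewrite rdistC.
  have {1}<- : iter n (average t) x = x.
    by elim: n => // n IH; rewrite iterS IH average_fixed.
  exact: PK.
- rewrite P'E; apply: (ler_addgeo q01) => n.
  rewrite -[P x](subrK (iter n (average t) x)) (le_trans (ler_rnormD _ _))//.
  by rewrite addrC lerD// ?rnorm_iter_average// rdistC.
Qed.


End Representation.

(** * Pairings, the weak-star topology and preadjoints *)

Lemma functional_in_span (K : fieldType) (X Y : lmodType K)
    (J : X -> Y -> K) (l : seq Y) (g : X -> K) :
  (forall a x x' y, J (a *: x + x') y = a * J x y + J x' y) ->
  (forall x, linear (J x : Y -> K^o)) ->
  (forall a x x', g (a *: x + x') = a * g x + g x') ->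
  (forall x, (forall y, y \in l -> J x y = 0) -> g x = 0) ->
  exists y, forall x, g x = J x y.
Proof.
move=> Jl Jr; elim: l g => [|y0 l IH] g gl gker.
  exists 0 => x; rewrite gker//.
  by have := Jr x (-1) 0 0; rewrite scaler0 addr0 scaleN1r addNr.
(* If some [z] is killed by [l] but not by [y0], subtracting from [g] the multiple of [J ^~ y0] that
   agrees with it at [z] reduces to [l]. Otherwise [y0] adds no condition to the common kernel of
   [l]. *)
have [[z [zl z0]]|no] := pselect (exists z, (forall y, y \in l -> J z y = 0) /\
    J z y0 != 0).
  pose c := g z / J z y0.
  have [|x xl|y yE] := IH (fun x => g x - c * J x y0).
  - by move=> a x x'; rewrite gl Jl; ring.
  (* This [b] makes [b *: z + x] vanish against [y0] as well. *)
  - pose b := - (J x y0 / J z y0).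
    have : g (b *: z + x) = 0.
      apply: gker => y; rewrite in_cons Jl => /predU1P[->|yl].
        by rewrite /b; field.
      by rewrite zl// xl// mulr0 addr0.
    by rewrite gl /b /c => <-; field.
  - exists (c *: y0 + y) => x; rewrite Jr -yE /GRing.scale /=; ring.
apply: IH => // x xl; apply: gker => y; rewrite in_cons => /predU1P[->|/xl//].
by have [//|x0] := eqVneq (J x y0) 0; exfalso; apply: no; exists x.
Qed.

Lemma cvge0_le (R : realType) (T : Type) (F : set_system T) (g : T -> \bar R) :
  Filter F -> (forall t, 0 <= g t)%E ->
  (forall e : R, 0 < e -> \forall t \near F, (g t <= e%:E)%E) ->
  g t @[t --> F] --> 0%E.
Proof.
move=> FF g0 ge.
have gf t e : (g t <= e%:E)%E -> g t \is a fin_num.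
  by move=> ge'; rewrite ge0_fin_numE// (le_lt_trans ge')// ltry.
apply/fine_cvgP; split; first by apply: filterS (ge 1 ltr01) => t; exact: gf.
apply/cvgrPdist_le => e e0; apply: filterS (ge e e0) => t te.
rewrite /= sub0r normrN ger0_norm ?fine_ge0//.
by rewrite -lee_fin fineK// (gf _ e).
Qed.

Section WeakStar.
Context {R : realType} {X Y : completeNormedModType R[i]}.
Variable J : X -> {linear Y -> R[i]^o}.
Hypothesis Jiso : dual_iso J.

Lemma dual_isoP (a : R[i]) x x' y : J (a *: x + x') y = a * J x y + J x' y.
Proof. by case: Jiso. Qed.

Lemma dual_iso0 y : J 0 y = 0.
Proof. by have := dual_isoP (-1) 0 0 y; rewrite scaler0 addr0 mulN1r addNr. Qed.

Lemma dual_isoB x x' y : J (x - x') y = J x y - J x' y.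
Proof. by rewrite -scaleN1r addrC dual_isoP mulN1r addrC. Qed.

Lemma rnorm_dual_iso x y : rnorm (J x y) <= rnorm x * rnorm y.
Proof.
case: Jiso => _ Jn _; apply: le_opnorm; last by rewrite Jn.
by move=> a z; rewrite linearZ.
Qed.

Lemma dual_iso_inj x x' : (forall y, J x y = J x' y) -> x = x'.
Proof.
move=> xx'; apply/subr0_eq/rnorm_eq0.
case: Jiso => _ Jn _; apply/EFin_inj; rewrite -Jn; apply/eqP.
rewrite eq_le opnorm_ge0 ?linear0// andbT; apply: opnorm_le => // y.
by rewrite dual_isoB xx' subrr rnorm0 mul0r.
Qed.

Lemma dual_iso_rnorm_le x r : 0 <= r ->
  (forall y, rnorm (J x y) <= r * rnorm y) -> rnorm x <= r.
Proof.
move=> r0 xr; case: Jiso => _ Jn _; rewrite -lee_fin -Jn.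
exact: opnorm_le.
Qed.

(** Generated by the basic weak-star neighbourhoods of [0]; their explicit finite lists are what
    [functional_in_span] takes as input. *)
Definition weak_star0 : set_system X :=
  filter_from [set p : seq Y * R | 0 < p.2]
    (fun p => [set z | forall y, y \in p.1 -> rnorm (J z y) <= p.2]).

Lemma weak_star0_filter : Filter weak_star0.
Proof.
apply: filter_from_filter; first by exists ([::], 1) => /=.
move=> [l e] [l' e'] /= e0 e'0; exists (l ++ l', Num.min e e') => /=.
  by rewrite lt_min e0.
move=> z /= zl; split=> y yl.
  have := zl y; rewrite mem_cat yl => /(_ isT); rewrite le_min.
  by case/andP.
have := zl y; rewrite mem_cat yl orbT => /(_ isT); rewrite le_min.
by case/andP.
Qed.

Lemma weak_star0_cvg : weak_star0 --> (0 : weak_star J).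
Proof.
have FF := weak_star0_filter.
pose w := fun x : X => (J x : {ptws Y -> R[i]^o}).
have w0 : w @ weak_star0 --> w 0.
  apply/pointwise_cvgP => y; apply/cvgrPdist_le => e e0.
  have eR : e = (complex.Re e)%:C%C by rewrite RRe_real// gtr0_real.
  exists ([:: y], complex.Re e) => /=; first by rewrite -ltcR -eR.
  move=> z /= /(_ y (mem_head _ _)); rewrite [w 0 y]dual_iso0 sub0r normrN => ze.
  by rewrite eR rnormE lecR.
move=> A [_ [[B Bo <-] Bw0 BA]].
have : nbhs (w 0) B by apply: open_nbhs_nbhs.
move=> /w0; rewrite /nbhs /= /nbhs /=; apply: filterS => z Bz.
exact: BA.
Qed.

(** Continuity at [0] bounds [J (f x) y] on a basic neighbourhood given by a finite list [l]. The
    common kernel of [l] is a subspace inside it, and a linear functional bounded on a subspace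
    vanishes there. *)
Lemma weak_star_preadjoint (f : {linear X -> X}) : weak_star_continuous J f ->
  forall y, exists y', forall x, J (f x) y = J x y'.
Proof.
move=> fc y; have FF := weak_star0_filter.
pose w := fun x : X => (J x : {ptws Y -> R[i]^o}).
have c1 : (f x : weak_star J) @[x --> weak_star0] --> (f 0 : weak_star J).
  exact: cvg_trans (cvg_app _ weak_star0_cvg) (fc 0).
have c2 : w (f x) @[x --> weak_star0] --> w (f 0).
  exact: cvg_trans (cvg_app _ c1) (@initial_continuous _ _ w (f 0)).
have c3 : J (f x) y @[x --> weak_star0] --> (J (f 0) y : R[i]^o).
  by move/pointwise_cvgP : c2 => /(_ y).
have /cvgrPdist_le/(_ 1 ltr01)[[l e] /= e0 le1] := c3.
apply: (@functional_in_span _ X Y J l (fun x => J (f x) y)).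
- exact: dual_isoP.
- by move=> x a u v; rewrite linearP.
- by move=> a x x'; rewrite linearP dual_isoP.
- move=> x xl; apply/eqP/negPn/negP => x0.
  (* Rescaling gives the functional the value [2], above the bound [1], while the pairings with [l]
     stay [0]. *)
  pose a := (2 : R[i]) / J (f x) y.
  have ax z : J (a *: x) z = a * J x z.
    by rewrite -[a *: x]addr0 dual_isoP dual_iso0 addr0.
  have ae z : z \in l -> rnorm (J (a *: x) z) <= e.
    by move=> zl; rewrite ax xl// mulr0 rnorm0 ltW.
  have := le1 (a *: x) ae; rewrite /=.
  have -> : f (a *: x) = a *: f x by rewrite linearZ.
  rewrite (linear0 f) dual_iso0 sub0r normrN -[a *: _]addr0 dual_isoP dual_iso0.
  rewrite addr0 /a divfK// ger0_norm//.
  by move=> /le_gtF; rewrite (ltr1n R[i] 2).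
Qed.

End WeakStar.

(** * Invariant means of matrix coefficients and the amenable case *)

Section AmenableProjection.
Context {R : realType} {X Y : completeNormedModType R[i]}.
Context {S : topologicalGroupType} (alpha : S -> {linear X -> X}) (C : R).
Hypothesis alpha_mul : forall (s t : S) (x : X),
  alpha (s * t)%g x = alpha s (alpha t x).
Hypothesis alphaC : forall s x, rnorm (alpha s x) <= C * rnorm x.
Hypothesis C0 : 0 < C.
Hypothesis alpha_cont : forall s : S,
  opnorm (fun x : X => alpha t x - alpha s x) @[t --> s] --> 0%E.
Variable J : X -> {linear Y -> R[i]^o}.
Hypothesis Jiso : dual_iso J.

Definition coef (x : X) (y : Y) : S -> R[i] := fun s => J (alpha s x) y.

Lemma rnorm_coef x y r : (forall s, rnorm (alpha s x) <= r) ->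
  forall s, rnorm (coef x y s) <= r * rnorm y.
Proof.
move=> xr s; rewrite (le_trans (rnorm_dual_iso Jiso _ _))//.
by rewrite ler_wpM2r// rnorm_ge0.
Qed.

Lemma coef_linearl a x x' y :
  coef (a *: x + x') y = (fun s => a * coef x y s + coef x' y s).
Proof. by apply/funext => s; rewrite /coef linearP (dual_isoP Jiso). Qed.

Lemma coef_linearr a x y y' :
  coef x (a *: y + y') = (fun s => a * coef x y s + coef x y' s).
Proof. by apply/funext => s; rewrite /coef linearP. Qed.

(** Norm continuity acts on the vectors [alpha u x], all of norm at most [C * rnorm x], hence the
    uniformity in [u]. Taking [u = 1] gives plain continuity of the coefficient. *)
Lemma near_coef s x y (e : R) : 0 < e ->
  \forall t \near s, forall u,
    rnorm (coef x y (t * u)%g - coef x y (s * u)%g) <= e.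
Proof.
move=> e0; pose K := C * rnorm x * rnorm y + 1.
have K0 : 0 < K by rewrite ltr_wpDl// !mulr_ge0 ?rnorm_ge0// ltW.
have := near_rnorm_le (alpha_cont s) (divr_gt0 e0 K0).
apply: filterS => t ts u; rewrite /coef !alpha_mul -(dual_isoB Jiso).
rewrite (le_trans (rnorm_dual_iso Jiso _ _))//.
apply: (@le_trans _ _ (e / K * (C * rnorm x) * rnorm y)).
  rewrite ler_wpM2r ?rnorm_ge0// (le_trans (ts _))// ler_wpM2l//.
  by rewrite divr_ge0// ltW.
rewrite -mulrA -mulrA -[leRHS]mulr1 ler_pM2l// ler_pdivrMl// mulr1.
by rewrite /K lerDl.
Qed.

Lemma coef_RUCb x y : RUCb (coef x y).
Proof.
split.
- apply: (@le_lt_trans _ _ (C * rnorm x * rnorm y)%:E); last exact: ltry.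
  apply: ge_ereal_sup => _ [s _ <-]; rewrite lee_fin.
  exact: rnorm_coef.
- move=> s; apply/cvgrPdist_le => e e0.
  have eR : e = (complex.Re e)%:C%C by rewrite RRe_real// gtr0_real.
  have e1 : 0 < complex.Re e by rewrite -ltcR -eR.
  apply: filterS (near_coef s x y e1) => t /(_ 1%g).
  by rewrite !mulg1 eR rnormE lecR rdistC.
- move=> s; apply: cvge0_le => [t|e e0].
    apply: le_trans (ereal_sup_ubound _); last by exists 1%g.
    by rewrite lee_fin rnorm_ge0.
  apply: filterS (near_coef s x y e0) => t ts.
  by apply: ge_ereal_sup => _ [u _ <-]; rewrite lee_fin; exact: ts.
Qed.

Lemma cst_RUCb (a : R[i]) : @RUCb R S (fun=> a).
Proof.
split.
- apply: (@le_lt_trans _ _ (rnorm a)%:E); last exact: ltry.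
  by apply: ge_ereal_sup => _ [s _ <-].
- by move=> s; exact: cvg_cst.
- move=> s; apply: cvge0_le => [t|e e0].
    apply: le_trans (ereal_sup_ubound _); last by exists 1%g.
    by rewrite lee_fin rnorm_ge0.
  apply: nearW => t; apply: ge_ereal_sup => _ [u _ <-].
  by rewrite /ltranslate subrr rnorm0 lee_fin ltW.
Qed.

Variable mu : (S -> R[i]) -> R[i].
Hypothesis mu_linear : RUCb_linear mu.
Hypothesis mu_norm : RUCb_dual_norm mu = 1%E.
Hypothesis mu1 : mu (fun=> 1) = 1.
Hypothesis mu_inv : forall (t : S) (f : S -> R[i]), RUCb f ->
  mu (ltranslate t f) = mu f.

Lemma mean_cst a : mu (fun=> a) = a.
Proof.
have mu0 : mu (fun=> 0) = 0.
  have := mu_linear (-1) (cst_RUCb 0) (cst_RUCb 0).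
  by rewrite mulr0 addr0 mulN1r addNr.
have := mu_linear a (cst_RUCb 1) (cst_RUCb 0).
by rewrite mu1 mu0 mulr1 !addr0.
Qed.

Lemma mean_coef_linearr x : linear (fun y => mu (coef x y) : R[i]^o).
Proof.
by move=> a y y'; rewrite coef_linearr mu_linear//; exact: coef_RUCb.
Qed.

Lemma mean_coef_linearl a x x' y :
  mu (coef (a *: x + x') y) = a * mu (coef x y) + mu (coef x' y).
Proof. by rewrite coef_linearl mu_linear//; exact: coef_RUCb. Qed.

(** The dual norm controls the unit ball, so [x] is rescaled by [(r + e)^-1]; the extra [e > 0]
    covers [r = 0] and is then removed. *)
Lemma rnorm_mean_coef x y r :
  (forall s, rnorm (coef x y s) <= r) -> rnorm (mu (coef x y)) <= r.
Proof.
move=> xr; apply/ler_addgt0Pr => e e0.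
have r0 : 0 <= r := le_trans (rnorm_ge0 _) (xr 1%g).
have re : 0 < r + e by rewrite ltr_wpDl.
pose a := ((r + e)^-1)%:C%C : R[i].
have an : rnorm a = (r + e)^-1 by rewrite rnorm_complex// invr_ge0 ltW.
have az z : a *: z = a *: z + (0 : X) by rewrite addr0.
have c0 : coef 0 y = (fun=> 0).
  by apply/funext => s; rewrite /coef linear0 (dual_iso0 Jiso).
have : ((rnorm (mu (coef (a *: x) y)))%:E <= 1%:E)%E.
  rewrite -mu_norm; apply: ereal_sup_ubound; exists (coef (a *: x) y) => //=.
  split; first exact: coef_RUCb.
  apply: ge_ereal_sup => _ [s _ <-]; rewrite lee_fin az coef_linearl c0 addr0.
  rewrite rnormM an mulrC ler_pdivrMr// mul1r (le_trans (xr s))//.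
  by rewrite lerDl ltW.
rewrite lee_fin az mean_coef_linearl c0 mean_cst addr0 rnormM an mulrC.
by rewrite ler_pdivrMr// mul1r.
Qed.

Hypothesis alpha_weak_star : forall s, weak_star_continuous J (alpha s).

Lemma amenable_projection : exists P : {linear X -> X},
  [/\ forall s x, alpha s (P x) = P x,
      forall x, (forall s, alpha s x = x) -> P x = x &
      forall x r, (forall s, rnorm (alpha s x) <= r) -> rnorm (P x) <= r].
Proof.
have mubound x y r : (forall s, rnorm (alpha s x) <= r) ->
    rnorm (mu (coef x y)) <= r * rnorm y.
  by move=> xr; apply: rnorm_mean_coef; exact: rnorm_coef.
have /choice[P PE] x : exists z, forall y, J z y = mu (coef x y).
  have [phi phiE] := linear_exists (mean_coef_linearr x).
  have [_ _ /(_ phi)[]] := Jiso.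
    apply: (@le_lt_trans _ _ (C * rnorm x)%:E); last exact: ltry.
    apply: opnorm_le => [|y]; first by rewrite mulr_ge0 ?rnorm_ge0// ltW.
    by rewrite phiE mubound.
  by move=> z zphi; exists z => y; rewrite zphi phiE.
have linP : linear P.
  move=> a x y; apply: (dual_iso_inj Jiso) => z.
  by rewrite (dual_isoP Jiso) !PE mean_coef_linearl.
have [P' P'E] := linear_exists linP.
exists P'; split => [s x|x xfix|x r xr].
- rewrite P'E; apply: (dual_iso_inj Jiso) => y.
  have [y' y'E] := weak_star_preadjoint Jiso (@alpha_weak_star s) y.
  rewrite y'E !PE -(mu_inv s (coef_RUCb x y)); congr mu.
  by apply/funext => u; rewrite /ltranslate /coef alpha_mul y'E.
(* A fixed vector has constant coefficients, and the mean preserves constants. *)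
- rewrite P'E; apply: (dual_iso_inj Jiso) => y; rewrite PE.
  rewrite -[RHS]mean_cst; congr mu.
  by apply/funext => s; rewrite /coef xfix.
- rewrite P'E; apply: (dual_iso_rnorm_le Jiso) => [|y].
    exact: le_trans (rnorm_ge0 _) (xr 1%g).
  by rewrite PE mubound.
Qed.

End AmenableProjection.

(** * Both cases combined: norm bound, range and idempotence *)

Theorem corollary3p9 (R : realType) (X : completeNormedModType R[i])
  (S : topologicalGroupType) (alpha : S -> {linear X -> X})
  (alpha_bounded : forall s : S, bounded_op (alpha s))
  (alpha_mul : forall (s t : S) (x : X),
     alpha (s * t)%g x = alpha s (alpha t x))
  (alpha_cont : forall s : S,
     opnorm (fun x : X => alpha t x - alpha s x) @[t --> s] --> 0%E)
  (alpha_one : forall x : X, alpha 1%g x = x)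
  (alpha_sup : (ereal_sup (range (fun s : S => opnorm (alpha s))) < +oo)%E)
  (hyp :
     (amenable R S /\
      exists (Y : completeNormedModType R[i]) (J : X -> {linear Y -> R[i]^o}),
        dual_iso J /\ forall s : S, weak_star_continuous J (alpha s))
     \/ compact [set: S]) :
  exists P : {linear X -> X},
    [/\ bounded_op P,
        (opnorm P <= ereal_sup (range (fun s : S => opnorm (alpha s))))%E,
        range P = [set x : X | forall s : S, alpha s x = x] &
        forall x : X, P (P x) = P x].
Proof.
pose c := ereal_sup (range (fun s : S => opnorm (alpha s))).
have c_le s : (opnorm (alpha s) <= c)%E by apply: ereal_sup_ubound; exists s.
have c0 : (0 <= c)%E by rewrite (le_trans _ (c_le 1%g))// opnorm_ge0// linear0.
have cf : c \is a fin_num by rewrite ge0_fin_numE.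
have fc0 : 0 <= fine c by rewrite fine_ge0.
have alphac s x : rnorm (alpha s x) <= fine c * rnorm x.
  apply: le_opnorm; first by move=> a y; rewrite linearZ.
  by rewrite fineK.
(* The supremum is [0] when [X] is trivial, whereas the compact case divides by the constant. *)
have C0 : 0 < fine c + 1 by rewrite ltr_wpDl.
have alphaC s x : rnorm (alpha s x) <= (fine c + 1) * rnorm x.
  by rewrite (le_trans (alphac s x))// ler_wpM2r ?rnorm_ge0// lerDl.
have [P [Pinv Pfix Pnorm]] : exists P : {linear X -> X},
    [/\ forall s x, alpha s (P x) = P x,
        forall x, (forall s, alpha s x = x) -> P x = x &
        forall x r, (forall s, rnorm (alpha s x) <= r) -> rnorm (P x) <= r].
  case: hyp => [[[mu [mul mun mu1 mui]] [Y [J [Jiso Jw]]]]|cS].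
    exact: (amenable_projection alpha_mul alphaC C0 alpha_cont Jiso mul mun mu1).
  exact: (compact_projection alpha_mul alpha_one alphaC C0 alpha_cont cS).
(* Here [Pnorm] is used with the orbit bound [fine c * rnorm x], so the added [1] does not enter the
   norm of [P]. *)
have Pc : (opnorm P <= c)%E.
  rewrite -(fineK cf); apply: opnorm_le => // x.
  by apply: Pnorm => s; exact: alphac.
exists P; split => //; first exact: le_lt_trans Pc alpha_sup.
- apply/seteqP; split => [_ [x _ <-] s|x xfix]; first exact: Pinv.
  by exists x => //; exact: Pfix.
- by move=> x; apply: Pfix => s; exact: Pinv.
Qed.
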